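(* Let $0<\alpha<\beta$, let $\Omega\subset\mathbb{R}^2\times\{\alpha\}$ be compact, let $Y_i=(y_i,\beta)$ with $y_i\in\mathbb{R}^2$, $1\le i\le N$, and let $\mathbf b=(b_1,\dots,b_N)\in\mathbb{R}^N$ satisfy $$|b_i-b_j|<\sqrt{4(\alpha-\beta)^2+|y_i-y_j|^2}\qquad\text{for all } i,j\in\{1,\dots,N\}.$$ Then for each $i\in\{1,\dots,N\}$ one has $$H_i(\mathbf b)=\mathrm{P}_{\mathbb{R}^2\times\{\alpha\}}\big(\mathrm{Pow}_i(Q)\cap\Sigma_i^+\big),$$ where $\mathrm{P}_{\mathbb{R}^2\times\{\alpha\}}$ is the orthogonal projection of $\mathbb{R}^3$ onto $\mathbb{R}^2\times\{\alpha\}$, $Q=\{(q_i,\omega_i)\}_{i=1}^N$ is the weighted point cloud with $q_i=(y_i,-b_i)\in\mathbb{R}^3$ and $\omega_i=-2b_i^2$, and $\Sigma_i^+=\{(x,|X-Y_i|+b_i): X=(x,\alpha),\ x\in\mathbb{R}^2\}\subset\mathbb{R}^3$. Therefore, $$\mathrm{Lag}_i(\mathbf b)=\mathrm{P}_{\mathbb{R}^2\times\{\alpha\}}\big(\mathrm{Pow}_i(Q)\cap\Sigma_i^+\cap\widehat\Omega\big),\qquad \widehat\Omega=\{(x,x_3)\in\mathbb{R}^2\times\mathbb{R}:(x,\alpha)\in\Omega\}.$$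
   Context: $|\cdot|$ denotes the Euclidean norm. For $1\le i\le N$: $$H_i(\mathbf b)=\{X\in\mathbb{R}^2\times\{\alpha\}: |X-Y_i|+b_i\le|X-Y_j|+b_j\ \ \forall\,1\le j\le N\}.$$ With $c(X,Y)=|X|+|X-Y|$, the Laguerre cells are $\mathrm{Lag}_i(\mathbf b)=\{X\in\Omega: c(X,Y_i)+b_i\le c(X,Y_k)+b_k\ \text{for all }1\le k\le N\}=H_i(\mathbf b)\cap\Omega$. For a weighted point cloud $Q=\{(q_i,\omega_i)\}_{1\le i\le N}$ with $q_i\in\mathbb{R}^3$, $\omega_i\in\mathbb{R}$, the $i$-th power cell is $$\mathrm{Pow}_i(Q)=\{x\in\mathbb{R}^3: |x-q_i|^2+\omega_i\le|x-q_j|^2+\omega_j\ \ \forall\, j\in\{1,\dots,N\}\}.$$ *)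

(* Defs.v *)
From HB Require Import structures.
From mathcomp Require Import all_boot all_order all_algebra.
From mathcomp Require Import all_classical all_reals all_analysis.

Set Implicit Arguments.
Unset Strict Implicit.
Unset Printing Implicit Defensive.

Import Order.TTheory GRing.Theory Num.Theory.
Import numFieldNormedType.Exports.
Local Open Scope classical_set_scope.
Local Open Scope ring_scope.

(* The library's norm [`|u|] on row vectors is the sup norm, so the Euclidean
   structure is introduced here; both induce the library's topology. *)
Definition dotv (R : realType) (n : nat) (u v : 'rV[R]_n) : R :=
  \sum_i u 0 i * v 0 i.

Definition enorm (R : realType) (n : nat) (u : 'rV[R]_n) : R :=
  Num.sqrt (dotv u u).

(* The point (x, t) of R^3 = R^2 x R. *)
Definition pt3 (R : realType) (x : 'rV[R]_2) (t : R) : 'rV[R]_3 :=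
  row_mx x (t%:M : 'M[R]_1).

Definition plane (R : realType) (a : R) : set 'rV[R]_3 :=
  [set pt3 x a | x in [set: 'rV[R]_2]].

(* Orthogonal projection onto an affine subspace A: the point p of A such that
   X - p is orthogonal to every direction a - p of A (junk value X if there is
   no such point; see orth_proj_plane). *)
Definition orth_proj (R : realType) (n : nat) (A : set 'rV[R]_n)
    (X : 'rV[R]_n) : 'rV[R]_n :=
  xget X [set p | A p /\ forall a, A a -> dotv (X - p) (a - p) = 0].

Definition Hcell (R : realType) (N : nat) (alpha : R) (Y : 'I_N -> 'rV[R]_3)
    (b : 'rV[R]_N) (i : 'I_N) : set 'rV[R]_3 :=
  [set X | plane alpha X /\
    forall j : 'I_N, enorm (X - Y i) + b 0 i <= enorm (X - Y j) + b 0 j].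

Definition cost (R : realType) (X Y : 'rV[R]_3) : R :=
  enorm X + enorm (X - Y).

Definition Lag (R : realType) (N : nat) (Omega : set 'rV[R]_3)
    (Y : 'I_N -> 'rV[R]_3) (b : 'rV[R]_N) (i : 'I_N) : set 'rV[R]_3 :=
  [set X | Omega X /\
    forall k : 'I_N, cost X (Y i) + b 0 i <= cost X (Y k) + b 0 k].

Definition Pow (R : realType) (N : nat) (Q : 'I_N -> 'rV[R]_3 * R)
    (i : 'I_N) : set 'rV[R]_3 :=
  [set x | forall j : 'I_N,
    enorm (x - (Q i).1) ^+ 2 + (Q i).2 <= enorm (x - (Q j).1) ^+ 2 + (Q j).2].

Definition Sigma_plus (R : realType) (N : nat) (alpha : R)
    (Y : 'I_N -> 'rV[R]_3) (b : 'rV[R]_N) (i : 'I_N) : set 'rV[R]_3 :=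
  [set pt3 x (enorm (pt3 x alpha - Y i) + b 0 i) | x in [set: 'rV[R]_2]].

Definition Omega_hat (R : realType) (alpha : R) (Omega : set 'rV[R]_3) :
    set 'rV[R]_3 :=
  [set Z | exists (x : 'rV[R]_2) (x3 : R),
    Z = pt3 x x3 /\ Omega (pt3 x alpha)].

Lemma pt3_lshift (R : realType) (x : 'rV[R]_2) (t : R) (k : 'I_2) :
  pt3 x t 0 (@lshift 2 1 k) = x 0 k.
Proof. exact: row_mxEl. Qed.

Lemma pt3_rshift (R : realType) (x : 'rV[R]_2) (t : R) (k : 'I_1) :
  pt3 x t 0 (@rshift 2 1 k) = t.
Proof. by rewrite ord1 [LHS]row_mxEr !mxE eqxx mulr1n. Qed.

Lemma dotv_pt3 (R : realType) (x y : 'rV[R]_2) (s t : R) :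
  dotv (pt3 x s) (pt3 y t) = dotv x y + s * t.
Proof.
rewrite /dotv (@big_split_ord _ _ _ 2 1) /= big_ord1 !pt3_rshift.
by congr (_ + _); apply: eq_bigr => k _; rewrite !pt3_lshift.
Qed.

Lemma pt3B (R : realType) (x y : 'rV[R]_2) (s t : R) :
  pt3 x s - pt3 y t = pt3 (x - y) (s - t).
Proof.
apply/rowP => k; rewrite mxE [X in _ + X]mxE; case: (@split_ordP 2 1 k) => j ->.
  by rewrite !pt3_lshift !mxE.
by rewrite !pt3_rshift.
Qed.

Lemma dotv_ge0 (R : realType) (n : nat) (u : 'rV[R]_n) : 0 <= dotv u u.
Proof. by apply: sumr_ge0 => k _; rewrite -expr2 sqr_ge0. Qed.

Lemma dotv_eq0 (R : realType) (n : nat) (u : 'rV[R]_n) : dotv u u = 0 -> u = 0.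
Proof.
move=> u0; apply/rowP => k; rewrite mxE; apply/eqP; rewrite -sqrf_eq0 expr2.
apply/eqP; apply: (psumr_eq0P _ u0) => // j _.
by rewrite -expr2 sqr_ge0.
Qed.

Lemma orth_proj_plane (R : realType) (a : R) (x : 'rV[R]_2) (t : R) :
  orth_proj (plane a) (pt3 x t) = pt3 x a.
Proof.
have dot0 (y : 'rV[R]_2) : dotv 0 y = 0.
  by apply: big1 => k _; rewrite mxE mul0r.
apply: xget_unique.
  split; first by exists x.
  by move=> _ [y _ <-]; rewrite !pt3B dotv_pt3 !subrr dot0 mulr0 addr0.
move=> _ [[y _ <-] orth]; have /orth : plane a (pt3 x a) by exists x.
rewrite !pt3B dotv_pt3 subrr mulr0 addr0 => /dotv_eq0 /eqP.
by rewrite subr_eq0 => /eqP->.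
Qed.

(* Main.v *)
Require Import Defs.
From HB Require Import structures.
From mathcomp Require Import all_boot all_order all_algebra.
From mathcomp Require Import all_classical all_reals all_analysis.
From mathcomp Require Import ring lra.

(** Write r_j for the distance from X = (x, alpha) to Y_j.  The inequalities
    defining [Hcell] compare r_i + b_i with r_j + b_j; the idea is to square it.  Lift X to
    the point (x, t) with t = r_i + b_i, which is the point of [Sigma_plus] above
    x.  Completing squares ([power_dist]), the power of (x, t) with respect to
    the j-th weighted point is r_j^2 - (t - b_j)^2 plus a quantity that does not
    depend on j, and r_i^2 - (t - b_i)^2 = 0.  So (x, t) lies in the i-th power
    cell iff |t - b_j| <= r_j for all j, whereas X lies in [Hcell] iff
    t - b_j <= r_j for all j.

    The two conditions differ by the inequality b_j - b_i <= r_i + r_j, and this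
    is what the bound on b provides: reflecting Y_j across the plane at height
    alpha does not change r_j, so by the triangle inequality r_i + r_j is at
    least the distance from Y_i to the reflected point, which is the square root
    in the hypothesis ([reflected_dist_le]).  Projecting (x, t) back to
    (x, alpha) then gives the equality of sets.  For [Lag], the summand |X| of
    the cost is the same on both sides of each defining inequality, and
    intersecting with [Omega_hat] upstairs is intersecting with [Omega] below. *)

Set Implicit Arguments.
Unset Strict Implicit.
Unset Printing Implicit Defensive.

Import Order.TTheory GRing.Theory Num.Theory.
Import numFieldNormedType.Exports.
Local Open Scope classical_set_scope.
Local Open Scope ring_scope.

Lemma dotvC (R : realType) (n : nat) (u v : 'rV[R]_n) : dotv u v = dotv v u.
Proof. by apply: eq_bigr => k _; rewrite mulrC. Qed.

Lemma dotvDl (R : realType) (n : nat) (u v w : 'rV[R]_n) :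
  dotv (u + v) w = dotv u w + dotv v w.
Proof.
by rewrite /dotv -big_split; apply: eq_bigr => k _; rewrite mxE mulrDl.
Qed.

Lemma dotvZl (R : realType) (n : nat) (a : R) (u v : 'rV[R]_n) :
  dotv (a *: u) v = a * dotv u v.
Proof. by rewrite /dotv mulr_sumr; apply: eq_bigr => k _; rewrite mxE mulrA. Qed.

Lemma enorm_ge0 (R : realType) (n : nat) (u : 'rV[R]_n) : 0 <= enorm u.
Proof. exact: sqrtr_ge0. Qed.

Lemma sqr_enorm (R : realType) (n : nat) (u : 'rV[R]_n) :
  enorm u ^+ 2 = dotv u u.
Proof. by rewrite sqr_sqrtr // dotv_ge0. Qed.

Lemma enorm_eq0 (R : realType) (n : nat) (u : 'rV[R]_n) : enorm u = 0 -> u = 0.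
Proof. by move=> u0; apply: dotv_eq0; rewrite -sqr_enorm u0 expr0n. Qed.

Lemma enormN (R : realType) (n : nat) (u : 'rV[R]_n) : enorm (- u) = enorm u.
Proof. by congr Num.sqrt; apply: eq_bigr => k _; rewrite !mxE mulrNN. Qed.

(** Cauchy-Schwarz, from the nonnegativity of the squared norm of
    |v| u - |u| v. *)
Lemma dotv_le_enorm (R : realType) (n : nat) (u v : 'rV[R]_n) :
  dotv u v <= enorm u * enorm v.
Proof.
have dot0l (w : 'rV[R]_n) : dotv 0 w = 0 by rewrite -(scale0r w) dotvZl mul0r.
have [/enorm_eq0 ->|u_neq0] := eqVneq (enorm u) 0.
  by rewrite dot0l mulr_ge0 ?enorm_ge0.
have [/enorm_eq0 ->|v_neq0] := eqVneq (enorm v) 0.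
  by rewrite dotvC dot0l mulr_ge0 ?enorm_ge0.
have uv_gt0 : 0 < enorm u * enorm v.
  by rewrite mulr_gt0 // lt_neqAle eq_sym enorm_ge0 ?u_neq0 ?v_neq0.
have := dotv_ge0 (enorm v *: u + (- enorm u) *: v).
rewrite dotvDl !dotvZl !(dotvC _ (_ + _)) !dotvDl !dotvZl (dotvC v u).
rewrite -!sqr_enorm => sq_ge0; rewrite -subr_ge0 -(pmulr_rge0 _ uv_gt0).
nra.
Qed.

Lemma ler_enormD (R : realType) (n : nat) (u v : 'rV[R]_n) :
  enorm (u + v) <= enorm u + enorm v.
Proof.
rewrite -ler_sqr ?nnegrE ?addr_ge0 ?enorm_ge0 //.
rewrite sqr_enorm dotvDl !(dotvC _ (_ + _)) !dotvDl (dotvC v u) -!sqr_enorm.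
by have := dotv_le_enorm u v; nra.
Qed.

Lemma sqr_enorm_pt3 (R : realType) (x : 'rV[R]_2) (t : R) :
  enorm (pt3 x t) ^+ 2 = enorm x ^+ 2 + t ^+ 2.
Proof. by rewrite !sqr_enorm dotv_pt3 expr2. Qed.

(** Completing the square in b: the only terms depending on the site (y, b) are
    the squared distance to (y, beta) and (t - b)^2. *)
Lemma power_dist (R : realType) (alpha beta t b : R) (x y : 'rV[R]_2) :
  enorm (pt3 x t - pt3 y (- b)) ^+ 2 - 2 * b ^+ 2
    = enorm (pt3 x alpha - pt3 y beta) ^+ 2 - (t - b) ^+ 2
      + (2 * t ^+ 2 - (alpha - beta) ^+ 2).
Proof. by rewrite !pt3B !sqr_enorm_pt3; ring. Qed.

(** The left side is the distance from (y, beta) to the mirror image of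
    (z, beta) in the plane at height alpha; the mirror image is as far from
    (x, alpha) as (z, beta) is. *)
Lemma reflected_dist_le (R : realType) (alpha beta : R) (x y z : 'rV[R]_2) :
  Num.sqrt (4 * (alpha - beta) ^+ 2 + enorm (y - z) ^+ 2)
    <= enorm (pt3 x alpha - pt3 y beta) + enorm (pt3 x alpha - pt3 z beta).
Proof.
(* (z, alpha) - (x, beta) is the vector from (x, alpha) to the mirror image
   (z, 2 alpha - beta). *)
have reflE : enorm (pt3 x alpha - pt3 z beta)
    = enorm (pt3 z alpha - pt3 x beta).
  by rewrite !pt3B /enorm !dotv_pt3 -!sqr_enorm -(enormN (x - z)) opprB.
have sumE : pt3 x alpha - pt3 y beta
    + (pt3 z alpha - pt3 x beta) = pt3 z (2 * (alpha - beta)) - pt3 y 0.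
  rewrite -[X in _ + X]opprB !pt3B; congr pt3; last by ring.
  by rewrite opprB addrC addrA subrK.
rewrite reflE; apply: le_trans (ler_enormD _ _).
rewrite sumE pt3B subr0 -[leRHS]ger0_norm ?enorm_ge0 // -sqrtr_sqr.
by rewrite sqr_enorm_pt3 -(enormN (z - y)) opprB exprMn addrC -natrX.
Qed.

(** Being in the power cell says t - b_j <= r_j in absolute value; the lower
    bound on t - b_j comes for free from the bound on b. *)
Lemma Pow_lift (R : realType) (N : nat) (alpha beta : R)
    (y : 'I_N -> 'rV[R]_2) (b : 'rV[R]_N) (i : 'I_N) (x : 'rV[R]_2)
    (hb : forall j : 'I_N,
      `|b 0 i - b 0 j|
        < Num.sqrt (4 * (alpha - beta) ^+ 2 + enorm (y i - y j) ^+ 2)) :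
  Pow (fun j => (pt3 (y j) (- b 0 j), - (2 * b 0 j ^+ 2))) i
      (pt3 x (enorm (pt3 x alpha - pt3 (y i) beta) + b 0 i))
  <-> forall j : 'I_N, enorm (pt3 x alpha - pt3 (y i) beta) + b 0 i
        <= enorm (pt3 x alpha - pt3 (y j) beta) + b 0 j.
Proof.
set r := fun k => enorm (pt3 x alpha - pt3 (y k) beta).
set t := r i + b 0 i.
suff powE (j : 'I_N) :
    (enorm (pt3 x t - pt3 (y i) (- b 0 i)) ^+ 2 - 2 * b 0 i ^+ 2
      <= enorm (pt3 x t - pt3 (y j) (- b 0 j)) ^+ 2 - 2 * b 0 j ^+ 2)
    = (t <= r j + b 0 j).
  by split=> h j; have := h j; rewrite /= powE.
rewrite (power_dist alpha beta t (b 0 i)) (power_dist alpha beta t (b 0 j)).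
rewrite lerD2r -/(r i) -/(r j) {1}/t addrK subrr subr_ge0.
rewrite -[(t - _) ^+ 2]real_normK ?num_real // ler_sqr ?nnegrE ?enorm_ge0 //.
rewrite ler_norml lerBlDr; apply: andb_idl => _.
have := le_trans (ltW (hb j)) (reflected_dist_le alpha beta x (y i) (y j)).
by rewrite ler_norml -/(r i) -/(r j) /t => /andP[b_ge _]; lra.
Qed.

(** The cost differs from the distance by |X|, which does not depend on the
    site. *)
Lemma Lag_Hcell (R : realType) (N : nat) (alpha : R) (Omega : set 'rV[R]_3)
    (Y : 'I_N -> 'rV[R]_3) (b : 'rV[R]_N) (i : 'I_N)
    (Omega_plane : Omega `<=` plane alpha) :
  Lag Omega Y b i = Hcell alpha Y b i `&` Omega.
Proof.
apply/seteqP; split=> X.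
  move=> [OX hX]; split=> //; split; first exact: Omega_plane.
  by move=> j; have := hX j; rewrite /cost -!addrA lerD2l.
by move=> [[_ hX] OX]; split=> // j; rewrite /cost -!addrA lerD2l.
Qed.

Theorem proposition4p3 (R : realType) (N : nat) (alpha beta : R)
    (Omega : set 'rV[R]_3) (y : 'I_N -> 'rV[R]_2) (b : 'rV[R]_N)
    (alpha_gt0 : 0 < alpha) (lt_alpha_beta : alpha < beta)
    (Omega_plane : Omega `<=` plane alpha) (Omega_compact : compact Omega)
    (hb : forall i j : 'I_N,
      `|b 0 i - b 0 j|
        < Num.sqrt (4 * (alpha - beta) ^+ 2 + enorm (y i - y j) ^+ 2)) :
  let Y := fun i : 'I_N => pt3 (y i) beta in
  let Q := fun i : 'I_N => (pt3 (y i) (- b 0 i), - (2 * b 0 i ^+ 2)) in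
  forall i : 'I_N,
    Hcell alpha Y b i
      = orth_proj (plane alpha) @` (Pow Q i `&` Sigma_plus alpha Y b i)
    /\ Lag Omega Y b i
      = orth_proj (plane alpha) @`
          (Pow Q i `&` Sigma_plus alpha Y b i `&` Omega_hat alpha Omega).
Proof.
move=> Y Q i.
have HcellE : Hcell alpha Y b i
    = orth_proj (plane alpha) @` (Pow Q i `&` Sigma_plus alpha Y b i).
  apply/seteqP; split=> X.
    move=> [[x _ <-] hX].
    exists (pt3 x (enorm (pt3 x alpha - Y i) + b 0 i)).
      by split; [apply/Pow_lift | exists x].
    exact: orth_proj_plane.
  move=> [Z [powZ [x _ ZE]] <-]; rewrite -ZE in powZ *; rewrite orth_proj_plane.
  by split; [exists x | exact/(Pow_lift x (hb i))].
split=> //; rewrite (Lag_Hcell _ _ _ Omega_plane) HcellE.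
apply/seteqP; split=> X.
  move=> [[Z [powZ sigZ] <-]]; case: (sigZ) => x _ ZE.
  rewrite -ZE orth_proj_plane => Ox; exists Z; last by rewrite -ZE orth_proj_plane.
  by split=> //; exists x, (enorm (pt3 x alpha - Y i) + b 0 i).
move=> [Z [ZPS [x [t [ZE Ox]]]] <-].
by split; [exists Z | rewrite ZE orth_proj_plane].
Qed.
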